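(* Let $n$ be a positive integer. Define a map $f\colon\mathcal{SV}(n)\to\mathcal{H}_n$, $\varphi\mapsto(h_{i,j})_{0\le i,j\le n}$, by letting $(h_{i,j})$ be the matrix in $\mathcal{H}_n$ (so in particular $h_{0,0}=0$) whose differences are $$h_{i,j}-h_{i,j-1}=\begin{cases}1&\text{if }\{(i,j),(i+1,j)\}\text{ comes in }(i,j)\text{ in }\varphi,\\-1&\text{otherwise,}\end{cases}\qquad(0\le i\le n,\ 0<j\le n),$$ $$h_{i,j}-h_{i-1,j}=\begin{cases}1&\text{if }\{(i,j),(i,j+1)\}\text{ goes out of }(i,j)\text{ in }\varphi,\\-1&\text{otherwise,}\end{cases}\qquad(0<i\le n,\ 0\le j\le n).$$ Then $f$ is a (well-defined) bijection from $\mathcal{SV}(n)$ to $\mathcal{H}_n$.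
   Context: Graph $L_n$: the interior vertices are the $(i,j)\in\mathbb{Z}^2$ with $1\le i,j\le n$; the boundary vertices are $(i,0),(i,n+1)$ for $1\le i\le n$ and $(0,j),(n+1,j)$ for $1\le j\le n$. The edges are the horizontal pairs $\{(i,j),(i,j+1)\}$ with $1\le i\le n$, $0\le j\le n$, and the vertical pairs $\{(i,j),(i+1,j)\}$ with $0\le i\le n$, $1\le j\le n$. Here $i$ is the row index (increasing downwards) and $j$ the column index (increasing to the right). An orientation assigns to each edge $\{u,v\}$ either $(u,v)$ or $(v,u)$; if it assigns $(u,v)$, the edge goes out of $u$ and comes in $v$. A state of the six vertex model on $L_n$ is an orientation for which every interior vertex has exactly two incident edges coming in and two going out. It has the open boundary condition if every vertical edge joining an interior vertex to a boundary vertex (at the top and bottom) comes in the boundary vertex, and every horizontal edge joining an interior vertex to a boundary vertex (at the left and right) goes out of the boundary vertex. $\mathcal{SV}(n)$ is the set of states of the six vertex model on $L_n$ with the open boundary condition. A height function of degree $n$ is an $(n+1)\times(n+1)$ matrix $(h_{i,j})_{0\le i,j\le n}$ such that $|h_{i+1,j}-h_{i,j}|=1$ for $0\le i<n$, $0\le j\le n$; $|h_{i,j+1}-h_{i,j}|=1$ for $0\le i\le n$, $0\le j<n$; and $h_{i,0}=h_{0,i}=h_{n-i,n}=h_{n,n-i}=i$ for $0\le i\le n$. $\mathcal{H}_n$ is the set of all height functions of degree $n$. *)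

(* Defs.v *)
From HB Require Import structures.
From mathcomp Require Import all_boot all_order all_algebra.
Set Implicit Arguments.
Unset Strict Implicit.
Unset Printing Implicit Defensive.
Import Order.TTheory GRing.Theory Num.Theory.
Local Open Scope ring_scope.

(* Ambient square {0, ..., n+1}^2, (row, column).  Its four corners are not
   vertices of L_n; they lie in neither of the two vertex sets below and on no
   edge. *)
Definition grid (n : nat) : Type := ('I_n.+2 * 'I_n.+2)%type.

(* The junk value of [inord] is never met: every use has i, j <= n.+1. *)
Definition pt (n i j : nat) : grid n := (inord i, inord j).

Definition interior (n : nat) : {set grid n} :=
  [set p : grid n | (1 <= p.1 <= n)%N && (1 <= p.2 <= n)%N].

Definition boundary (n : nat) : {set grid n} :=
  [set p : grid n | (1 <= p.1 <= n)%N && ((p.2 == 0%N :> nat) || (p.2 == n.+1 :> nat))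
        || (1 <= p.2 <= n)%N && ((p.1 == 0%N :> nat) || (p.1 == n.+1 :> nat))].

Definition hedge (n i j : nat) : {set grid n} := [set pt n i j; pt n i j.+1].
Definition vedge (n i j : nat) : {set grid n} := [set pt n i j; pt n i.+1 j].

Definition hedges (n : nat) : {set {set grid n}} :=
  [set e : {set grid n} | [exists i : 'I_n.+2, exists j : 'I_n.+1,
     (1 <= i <= n)%N && (e == hedge n i j)]].
Definition vedges (n : nat) : {set {set grid n}} :=
  [set e : {set grid n} | [exists i : 'I_n.+1, exists j : 'I_n.+2,
     (1 <= j <= n)%N && (e == vedge n i j)]].
Definition edges (n : nat) : {set {set grid n}} := hedges n :|: vedges n.

Definition edge (n : nat) : Type := {e : {set grid n} | e \in edges n}.

Definition is_orientation (n : nat) (o : {ffun edge n -> grid n * grid n}) :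
    bool :=
  [forall e : edge n, val e == [set (o e).1; (o e).2]].

Definition orientation (n : nat) : Type :=
  {o : {ffun edge n -> grid n * grid n} | is_orientation o}.

(* The pair (u, v) assigned to an edge goes out of u and comes in v. *)
Definition goes_out (n : nat) (o : orientation n) (e : {set grid n})
    (u : grid n) : bool :=
  [exists a : edge n, (val a == e) && ((val o a).1 == u)].
Definition comes_in (n : nat) (o : orientation n) (e : {set grid n})
    (v : grid n) : bool :=
  [exists a : edge n, (val a == e) && ((val o a).2 == v)].

Definition is_state (n : nat) (o : orientation n) : bool :=
  [forall v in interior n,
     (#|[set e in edges n | (v \in e) && comes_in o e v]| == 2)%N
  && (#|[set e in edges n | (v \in e) && goes_out o e v]| == 2)%N].

Definition open_boundary (n : nat) (o : orientation n) : bool :=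
  [forall u in interior n, forall v in boundary n,
      (([set u; v] \in vedges n) ==> comes_in o [set u; v] v)
   && (([set u; v] \in hedges n) ==> goes_out o [set u; v] v)].

Definition SV (n : nat) : Type :=
  {o : orientation n | is_state o && open_boundary o}.

(* Entries addressed by natural numbers i, j <= n. *)
Definition entry (n : nat) (h : 'M[int]_n.+1) (i j : nat) : int :=
  h (inord i) (inord j).

Definition is_height (n : nat) (h : 'M[int]_n.+1) : bool :=
  [&& [forall i : 'I_n, forall j : 'I_n.+1,
         `|entry h i.+1 j - entry h i j| == 1],
      [forall i : 'I_n.+1, forall j : 'I_n,
         `|entry h i j.+1 - entry h i j| == 1]
    & [forall i : 'I_n.+1,
         [&& entry h i 0 == i%:Z, entry h 0 i == i%:Z,
             entry h (n - i) n == i%:Z & entry h n (n - i) == i%:Z]]].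

Definition height_function (n : nat) : Type :=
  {h : 'M[int]_n.+1 | is_height h}.

Definition has_differences (n : nat) (phi : orientation n)
    (h : 'M[int]_n.+1) : Prop :=
  (forall i j : nat, (0 <= i <= n)%N -> (0 < j <= n)%N ->
     entry h i j - entry h i j.-1 =
       if comes_in phi (vedge n i j) (pt n i j) then 1 else -1) /\
  (forall i j : nat, (0 < i <= n)%N -> (0 <= j <= n)%N ->
     entry h i j - entry h i.-1 j =
       if goes_out phi (hedge n i j) (pt n i j) then 1 else -1).

(* Main.v *)
Require Import Defs.
From HB Require Import structures.
From mathcomp Require Import all_boot all_order all_algebra.
From mathcomp Require Import zify.
Set Implicit Arguments.
Unset Strict Implicit.
Unset Printing Implicit Defensive.
Import Order.TTheory GRing.Theory Num.Theory.
Local Open Scope ring_scope.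

(** An orientation of [L_n] is the same thing as one bit per edge: [up o i j]
    says that the vertical edge below [(i, j)] points up into [(i, j)], and
    [right o i j] that the horizontal edge to the right of [(i, j)] points
    away from it ([orientation_of_bits], [orientation_bits_inj]).  In these
    bits the ice rule at [(i, j)] is the single equation
      [up o i j + right o i (j-1) = up o (i-1) j + right o i j]
    ([stateP]): the two incoming edges and the two outgoing edges are
    complementary in the four edges at the vertex, so one of the two counts
    suffices, and rewriting each of its four terms by the bits gives the
    equation.

    Read the bits as the steps [1], [-1] of a would-be height function on the
    faces of the grid.  The ice rule at [(i, j)] then says exactly that the
    total step around the four faces meeting at [(i, j)] is zero, which is the
    condition for the steps to be the differences of some matrix, unique
    once its corner entry is [0].  So a state integrates to a matrix
    ([integrate_state]), and conversely the differences of a matrix with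
    steps of absolute value one are the bits of a state ([differences_state]).
    Finally, the open boundary condition says that the steps along the four
    sides are constant ([open_boundaryP]), which is the same as saying that
    the entries on the sides are the prescribed arithmetic progressions
    ([differences_height], [height_open_boundary]). *)

(** * Vertices and edges *)

Lemma val_pt1 n i j : (i <= n.+1)%N -> (pt n i j).1 = i :> nat.
Proof. by move=> hi; rewrite /= inordK. Qed.

Lemma val_pt2 n i j : (j <= n.+1)%N -> (pt n i j).2 = j :> nat.
Proof. by move=> hj; rewrite /= inordK. Qed.

Lemma pt_eq n i j k l :
  (i <= n.+1)%N -> (j <= n.+1)%N -> (k <= n.+1)%N -> (l <= n.+1)%N ->
  (pt n i j == pt n k l) = (i == k) && (j == l).
Proof.
move=> hi hj hk hl.
by rewrite xpair_eqE -!(inj_eq val_inj) /= !inordK.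
Qed.

Lemma pt_surj n (v : grid n) : v = pt n v.1 v.2.
Proof. by case: v => a b; rewrite /pt /= !inord_val. Qed.

Lemma pt_interior n i j :
  (i <= n.+1)%N -> (j <= n.+1)%N ->
  (pt n i j \in interior n) = (0 < i <= n)%N && (0 < j <= n)%N.
Proof. by move=> hi hj; rewrite inE val_pt1 // val_pt2. Qed.

Lemma pt_boundary n i j :
  (i <= n.+1)%N -> (j <= n.+1)%N ->
  (pt n i j \in boundary n) =
    (0 < i <= n)%N && ((j == 0%N) || (j == n.+1))
    || (0 < j <= n)%N && ((i == 0%N) || (i == n.+1)).
Proof. by move=> hi hj; rewrite inE val_pt1 // val_pt2. Qed.

Lemma hedgesP n (e : {set grid n}) :
  reflect (exists i j, [/\ (0 < i <= n)%N, (j <= n)%N & e = hedge n i j])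
          (e \in hedges n).
Proof.
rewrite inE; apply: (iffP existsP) => [[i /existsP[j /andP[hi /eqP->]]]|].
  by exists i, j; split=> //; rewrite -ltnS.
move=> [i [j [hi hj ->]]].
have hi2 : (i < n.+2)%N by lia.
exists (Ordinal hi2); apply/existsP; exists (Ordinal (hj : (j < n.+1)%N)).
by rewrite hi eqxx.
Qed.

Lemma vedgesP n (e : {set grid n}) :
  reflect (exists i j, [/\ (i <= n)%N, (0 < j <= n)%N & e = vedge n i j])
          (e \in vedges n).
Proof.
rewrite inE; apply: (iffP existsP) => [[i /existsP[j /andP[hj /eqP->]]]|].
  by exists i, j; split=> //; rewrite -ltnS.
move=> [i [j [hi hj ->]]].
have hj2 : (j < n.+2)%N by lia.
exists (Ordinal (hi : (i < n.+1)%N)); apply/existsP; exists (Ordinal hj2).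
by rewrite hj eqxx.
Qed.

Lemma hedge_edge n i j :
  (0 < i <= n)%N -> (j <= n)%N -> hedge n i j \in edges n.
Proof. by move=> hi hj; rewrite inE; apply/orP; left; apply/hedgesP; exists i, j. Qed.

Lemma vedge_edge n i j :
  (i <= n)%N -> (0 < j <= n)%N -> vedge n i j \in edges n.
Proof. by move=> hi hj; rewrite inE; apply/orP; right; apply/vedgesP; exists i, j. Qed.

Lemma hedge_neq n i j :
  (0 < i <= n)%N -> (j <= n)%N -> pt n i j != pt n i j.+1.
Proof. by move=> hi hj; rewrite pt_eq; lia. Qed.

Lemma vedge_neq n i j :
  (i <= n)%N -> (0 < j <= n)%N -> pt n i j != pt n i.+1 j.
Proof. by move=> hi hj; rewrite pt_eq; lia. Qed.

Lemma set2_eqP (T : finType) (x y p q : T) :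
  [set x; y] = [set p; q] -> (x = p /\ y = q) \/ (x = q /\ y = p).
Proof.
move=> E.
have : x \in [set p; q] by rewrite -E set21.
have : y \in [set p; q] by rewrite -E set22.
have : p \in [set x; y] by rewrite E set21.
have : q \in [set x; y] by rewrite E set22.
rewrite !inE => /orP[]/eqP ? /orP[]/eqP ? /orP[]/eqP ? /orP[]/eqP ?;
by subst; auto.
Qed.

Lemma hedge_inj n i j k l :
  (0 < i <= n)%N -> (j <= n)%N -> (0 < k <= n)%N -> (l <= n)%N ->
  hedge n i j = hedge n k l -> i = k /\ j = l.
Proof.
by move=> hi hj hk hl /set2_eqP[][/eqP+ /eqP]; rewrite !pt_eq; lia.
Qed.

Lemma vedge_inj n i j k l :
  (i <= n)%N -> (0 < j <= n)%N -> (k <= n)%N -> (0 < l <= n)%N ->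
  vedge n i j = vedge n k l -> i = k /\ j = l.
Proof.
by move=> hi hj hk hl /set2_eqP[][/eqP+ /eqP]; rewrite !pt_eq; lia.
Qed.

Lemma hedge_neq_vedge n i j k l :
  (0 < i <= n)%N -> (j <= n)%N -> (k <= n)%N -> (0 < l <= n)%N ->
  hedge n i j <> vedge n k l.
Proof.
by move=> hi hj hk hl /set2_eqP[][/eqP+ /eqP]; rewrite !pt_eq; lia.
Qed.

Definition star n i j : seq {set grid n} :=
  [:: vedge n i.-1 j; vedge n i j; hedge n i j.-1; hedge n i j].

Lemma star_uniq n i j :
  (0 < i <= n)%N -> (0 < j <= n)%N -> uniq (star n i j).
Proof.
move=> hi hj; rewrite /= !inE !negb_or -!andbA.
by apply/and5P; split=> //; [..|apply/and3P; split=> //]; apply/eqP;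
   first [ move/vedge_inj | move/hedge_inj
         | move/esym/hedge_neq_vedge ]; lia.
Qed.

Lemma mem_star n i j (e : {set grid n}) :
  (0 < i <= n)%N -> (0 < j <= n)%N ->
  (e \in star n i j) = (e \in edges n) && (pt n i j \in e).
Proof.
move=> hi hj; apply/idP/andP.
  rewrite !in_cons in_nil orbF => /or4P[]/eqP->; split;
    first [ apply: vedge_edge; lia | apply: hedge_edge; lia
          | by rewrite !inE !pt_eq; lia ].
case; rewrite inE => /orP[/hedgesP|/vedgesP] [k [l [hk hl ->]]].
  rewrite !inE !pt_eq; try lia.
  case/orP=> /andP[/eqP<- /eqP E]; rewrite -?E ?eqxx ?orbT //.
  by rewrite E eqxx !orbT.
rewrite !inE !pt_eq; try lia.
case/orP=> /andP[/eqP E /eqP<-]; rewrite ?E ?eqxx ?orbT //.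
Qed.

(** Turns the cardinals in the ice rule into sums of four explicit bits. *)
Lemma card_star n i j (P : pred {set grid n}) :
  (0 < i <= n)%N -> (0 < j <= n)%N ->
  #|[set e in edges n | (pt n i j \in e) && P e]| = count P (star n i j).
Proof.
move=> hi hj; rewrite -size_filter.
have /card_uniqP <- : uniq [seq e <- star n i j | P e].
  by rewrite filter_uniq // star_uniq.
by apply: eq_card => e; rewrite inE mem_filter mem_star // andbA andbC.
Qed.

(** * Orientations as families of bits *)

Lemma orientation_pair n (o : orientation n) (a : edge n) :
  val a = [set (val o a).1; (val o a).2].
Proof. by apply/eqP; have /forallP := valP o; apply. Qed.

Lemma goes_outE n (o : orientation n) (a : edge n) u :
  goes_out o (val a) u = ((val o a).1 == u).
Proof.
apply/existsP/idP => [[b /andP[/eqP/val_inj-> //]]|h].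
by exists a; rewrite eqxx.
Qed.

Lemma comes_inE n (o : orientation n) (a : edge n) u :
  comes_in o (val a) u = ((val o a).2 == u).
Proof.
apply/existsP/idP => [[b /andP[/eqP/val_inj-> //]]|h].
by exists a; rewrite eqxx.
Qed.

(** An edge carries one bit of information: its two ends being distinct, the
    pair assigned to it is [(p, q)] or [(q, p)], and [goes_out o e p] tells
    which.  It serves to express every occurrence of [comes_in] and [goes_out]
    by one chosen bit of the edge. *)
Lemma edge_bits n (o : orientation n) (e : {set grid n}) p q :
  e \in edges n -> e = [set p; q] -> p != q ->
  [/\ comes_in o e p = ~~ goes_out o e p, comes_in o e q = goes_out o e p
    & goes_out o e q = ~~ goes_out o e p].
Proof.
move=> he E pq; pose a : edge n := Sub e he.
rewrite -[e]/(val a) !comes_inE !goes_outE.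
have := orientation_pair o a; rewrite [val a]E.
by case/set2_eqP=> [][<- <-]; rewrite !eqxx (negPf pq) eq_sym (negPf pq).
Qed.

Definition up n (o : orientation n) i j : bool :=
  comes_in o (vedge n i j) (pt n i j).

Definition right n (o : orientation n) i j : bool :=
  goes_out o (hedge n i j) (pt n i j).

Lemma vedge_bits n (o : orientation n) i j :
  (i <= n)%N -> (0 < j <= n)%N ->
  [/\ goes_out o (vedge n i j) (pt n i j) = ~~ up o i j,
      comes_in o (vedge n i j) (pt n i.+1 j) = ~~ up o i j
    & goes_out o (vedge n i j) (pt n i.+1 j) = up o i j].
Proof.
move=> hi hj.
have [E -> ->] := edge_bits o (vedge_edge hi hj) erefl (vedge_neq hi hj).
by rewrite /up E !negbK.
Qed.

Lemma hedge_bits n (o : orientation n) i j :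
  (0 < i <= n)%N -> (j <= n)%N ->
  [/\ comes_in o (hedge n i j) (pt n i j) = ~~ right o i j,
      comes_in o (hedge n i j) (pt n i j.+1) = right o i j
    & goes_out o (hedge n i j) (pt n i j.+1) = ~~ right o i j].
Proof.
by move=> hi hj; apply: edge_bits; [apply: hedge_edge|..|apply: hedge_neq].
Qed.

Lemma orientation_bits_inj n (o o' : orientation n) :
  (forall i j, (i <= n)%N -> (0 < j <= n)%N -> up o i j = up o' i j) ->
  (forall i j, (0 < i <= n)%N -> (j <= n)%N -> right o i j = right o' i j) ->
  o = o'.
Proof.
move=> hup hright; apply/val_inj/ffunP => a.
(* It suffices that each edge has an end at which the two bits agree. *)
suff [p [q [pq E hbit]]] : exists p q, [/\ p != q, val a = [set p; q] &
    goes_out o (val a) p = goes_out o' (val a) p].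
  move: hbit; rewrite !goes_outE.
  have := orientation_pair o a; have := orientation_pair o' a; rewrite E.
  case: (val o a) (val o' a) => [x y] [x' y'] /=.
  by case/set2_eqP=> [][<- <-] /set2_eqP[][<- <-] //;
     rewrite !eqxx ?(eq_sym q) (negPf pq).
have := valP a; rewrite inE => /orP[/hedgesP|/vedgesP] [i [j [hi hj E]]].
  exists (pt n i j), (pt n i j.+1); split=> //; first exact: hedge_neq.
  by rewrite E; apply: hright.
exists (pt n i j), (pt n i.+1 j); split=> //; first exact: vedge_neq.
rewrite E; have [-> _ _] := vedge_bits o hi hj.
by have [-> _ _] := vedge_bits o' hi hj; rewrite hup.
Qed.

(** The bits can be prescribed independently on the edges, because an edge is
    [hedge n i j] or [vedge n i j] for exactly one kind and one [(i, j)]. *)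
Lemma orientation_of_bits n (V H : nat -> nat -> bool) :
  exists o : orientation n,
    (forall i j, (i <= n)%N -> (0 < j <= n)%N -> up o i j = V i j) /\
    (forall i j, (0 < i <= n)%N -> (j <= n)%N -> right o i j = H i j).
Proof.
pose good (a : edge n) (p : grid n * grid n) :=
  [/\ val a = [set p.1; p.2],
      forall i j, (i <= n)%N -> (0 < j <= n)%N -> val a = vedge n i j ->
        (p.2 == pt n i j) = V i j
    & forall i j, (0 < i <= n)%N -> (j <= n)%N -> val a = hedge n i j ->
        (p.1 == pt n i j) = H i j].
have /fin_all_exists[s hs] : forall a, exists p, good a p.
  move=> a; have := valP a.
  rewrite inE => /orP[/hedgesP|/vedgesP] [i [j [hi hj E]]].
    exists (if H i j then (pt n i j, pt n i j.+1) else (pt n i j.+1, pt n i j)).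
    split.
    - by rewrite E; case: ifP => _ //; rewrite setUC.
    - by move=> k l hk hl; rewrite E => /hedge_neq_vedge; case.
    - move=> k l hk hl; rewrite E => /hedge_inj[] // <- <-.
      case: (H i j) => /=; first by rewrite eqxx.
      by rewrite eq_sym (negPf (hedge_neq hi hj)).
  exists (if V i j then (pt n i.+1 j, pt n i j) else (pt n i j, pt n i.+1 j)).
  split.
  - by rewrite E; case: ifP => _ //; rewrite setUC.
  - move=> k l hk hl; rewrite E => /vedge_inj[] // <- <-.
    case: (V i j) => /=; first by rewrite eqxx.
    by rewrite eq_sym (negPf (vedge_neq hi hj)).
  - by move=> k l hk hl; rewrite E => /esym/hedge_neq_vedge; case.
have os : is_orientation [ffun a => s a].
  by apply/forallP=> a; rewrite ffunE; have [->] := hs a.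
pose o : orientation n := Sub _ os.
exists o; split=> i j hi hj.
  pose a : edge n := Sub (vedge n i j) (vedge_edge hi hj).
  rewrite /up -[vedge n i j]/(val a) comes_inE ffunE.
  by have [_ + _] := hs a; apply.
pose a : edge n := Sub (hedge n i j) (hedge_edge hi hj).
rewrite /right -[hedge n i j]/(val a) goes_outE ffunE.
by have [_ _] := hs a; apply.
Qed.

(** * States and the boundary condition in bits *)

(** Cancelling complementary bits, both counts of the ice rule become the same
    equation; it is arranged so that no negated bit is left. *)
Lemma stateP n (o : orientation n) :
  reflect (forall i j, (0 < i <= n)%N -> (0 < j <= n)%N ->
             (up o i j + right o i j.-1 = up o i.-1 j + right o i j)%N)
          (is_state o).
Proof.
have counts i j : (0 < i <= n)%N -> (0 < j <= n)%N ->
    let v := pt n i j in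
    #|[set e in edges n | (v \in e) && comes_in o e v]| =
      (~~ up o i.-1 j + (up o i j + (right o i j.-1 + ~~ right o i j)))%N /\
    #|[set e in edges n | (v \in e) && goes_out o e v]| =
      (up o i.-1 j + (~~ up o i j + (~~ right o i j.-1 + right o i j)))%N.
  move=> hi hj /=.
  rewrite (card_star (fun e => comes_in o e _)) //.
  rewrite (card_star (fun e => goes_out o e _)) //= !addn0.
  have hi1 : (i.-1 <= n)%N by lia.
  have hj1 : (j.-1 <= n)%N by lia.
  have [hi2 hj2] : (i <= n)%N /\ (j <= n)%N by lia.
  have [_ + +] := vedge_bits o hi1 hj; rewrite prednK; last by lia.
  move=> -> ->; have [-> _ _] := vedge_bits o hi2 hj.
  have [_ + +] := hedge_bits o hi hj1; rewrite prednK; last by lia.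
  by move=> -> ->; have [-> _ _] := hedge_bits o hi hj2.
apply: (iffP forall_inP) => [h i j hi hj|h v].
  have := h (pt n i j); have [-> ->] := counts i j hi hj.
  rewrite pt_interior ?hi ?hj; [|lia..] => /(_ isT).
  by case: (up o i j) (up o i.-1 j) (right o i j) (right o i j.-1)
    => [] [] [] [].
rewrite (pt_surj v) pt_interior; [|by rewrite -ltnS..] => /andP[hi hj].
have [-> ->] := counts _ _ hi hj; have := h _ _ hi hj.
by case: (up o _ _) (up o _.-1 _) (right o _ _) (right o _ _.-1)
  => [] [] [] [].
Qed.

(** A boundary vertex lies on one edge, so the pairs [u], [v] of the condition
    are the end pairs of the outermost edges on the four sides. *)
Lemma open_boundaryP n (o : orientation n) :
  reflect (forall k, (0 < k <= n)%N ->
             [/\ up o 0 k, ~~ up o n k, right o k 0 & ~~ right o k n])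
          (open_boundary o).
Proof.
apply: (iffP forall_inP) => [h k hk|h u _].
  have hb u v : u \in interior n -> v \in boundary n ->
      ([set u; v] \in vedges n -> comes_in o [set u; v] v) /\
      ([set u; v] \in hedges n -> goes_out o [set u; v] v).
    by move=> hu hv; have /forall_inP/(_ v hv)/andP[/implyP ? /implyP ?] := h u hu.
  split.
  - have [|| + _] := hb (pt n 1 k) (pt n 0 k).
    + by rewrite pt_interior; lia.
    + by rewrite pt_boundary; lia.
    by rewrite setUC; apply; apply/vedgesP; exists 0, k.
  - have [|| + _] := hb (pt n n k) (pt n n.+1 k).
    + by rewrite pt_interior; lia.
    + by rewrite pt_boundary; lia.
    have [_ E _] := vedge_bits o (leqnn n) hk.
    by rewrite E; apply; apply/vedgesP; exists n, k.
  - have [|| _] := hb (pt n k 1) (pt n k 0).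
    + by rewrite pt_interior; lia.
    + by rewrite pt_boundary; lia.
    by rewrite setUC; apply; apply/hedgesP; exists k, 0.
  - have [|| _] := hb (pt n k n) (pt n k n.+1).
    + by rewrite pt_interior; lia.
    + by rewrite pt_boundary; lia.
    have [_ _ E] := hedge_bits o hk (leqnn n).
    by rewrite E; apply; apply/hedgesP; exists k, n.
apply/forall_inP => v hv; apply/andP; split; apply/implyP.
  case/vedgesP=> i [j [hi hj E]]; rewrite E; have [hup hdown _ _] := h j hj.
  case/set2_eqP: E hv => -[_ ->]; rewrite pt_boundary; try lia.
    move=> hv; have {hv}? : i = n by lia.
    by subst i; have [_ -> _] := vedge_bits o hi hj.
  by move=> hv; have {hv}-> : i = 0%N by lia; exact: hup.
case/hedgesP=> i [j [hi hj E]]; rewrite E; have [_ _ hleft hright] := h i hi.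
case/set2_eqP: E hv => -[_ ->]; rewrite pt_boundary; try lia.
  move=> hv; have {hv}? : j = n by lia.
  by subst j; have [_ _ ->] := hedge_bits o hi hj.
by move=> hv; have {hv}-> : j = 0%N by lia; exact: hleft.
Qed.

(** * Matrices with given differences *)

Lemma arith_progression (f : nat -> int) (c : int) n :
  (forall k, (k < n)%N -> f k.+1 - f k = c) ->
  forall k, (k <= n)%N -> f k = f 0%N + c * k%:Z.
Proof.
move=> h; elim=> [|k IH] hk; first by rewrite mulr0 addr0.
by have := h k hk; rewrite IH; lia.
Qed.

Lemma entry_inj n (h h' : 'M[int]_n.+1) :
  (forall i j, (i <= n)%N -> (j <= n)%N -> entry h i j = entry h' i j) ->
  h = h'.
Proof.
move=> E; apply/matrixP => i j.
by have := E i j; rewrite /entry !inord_val; apply; rewrite -ltnS.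
Qed.

Lemma height_sides n (h : 'M[int]_n.+1) : is_height h ->
  forall k, (k <= n)%N ->
  [/\ entry h k 0 = k%:Z, entry h 0 k = k%:Z,
      entry h k n = (n - k)%N%:Z & entry h n k = (n - k)%N%:Z].
Proof.
case/and3P=> _ _ /forallP side k hk.
have [/and4P[/eqP-> /eqP-> _ _]] := side (Ordinal (hk : (k < n.+1)%N)).
have hk' : (n - k < n.+1)%N by lia.
have /and4P[_ _ /eqP+ /eqP+] := side (Ordinal hk').
by rewrite /= subKn.
Qed.

(** Any entry is reached from the corner by going down column [0] and then
    along a row. *)
Lemma differences_inj n (o : orientation n) (h h' : 'M[int]_n.+1) :
  has_differences o h -> has_differences o h' ->
  entry h 0 0 = entry h' 0 0 -> h = h'.
Proof.
move=> [row col] [row' col'] E; apply: entry_inj => i j hi hj.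
elim: j hj => [|j IH] hj; last first.
  have := row i j.+1; have := row' i j.+1; rewrite /=.
  by rewrite hi hj => /(_ isT isT) <- /(_ isT isT); rewrite IH; lia.
elim: i hi => // i IH hi.
have := col i.+1 0%N; have := col' i.+1 0%N; rewrite /=.
by rewrite hi => /(_ isT isT) <- /(_ isT isT); rewrite IH; lia.
Qed.

(** Each side is an arithmetic progression.  The left and top ones start from
    the corner entry [0]; the bottom and right ones start from [n], where the
    left and top ones end. *)
Lemma differences_height n (o : orientation n) (h : 'M[int]_n.+1) :
  has_differences o h -> entry h 0 0 = 0 -> open_boundary o -> is_height h.
Proof.
move=> [row col] h00 /open_boundaryP bd.
have rowS i j : (i <= n)%N -> (j < n)%N ->
    entry h i j.+1 - entry h i j = if up o i j.+1 then 1 else -1.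
  by move=> hi hj; apply: (row i j.+1).
have colS i j : (i < n)%N -> (j <= n)%N ->
    entry h i.+1 j - entry h i j = if right o i.+1 j then 1 else -1.
  by move=> hi hj; apply: (col i.+1 j).
have top k : (k <= n)%N -> entry h 0 k = k%:Z.
  move=> hk; rewrite (@arith_progression (entry h 0) 1 n) ?h00 //; first lia.
  by move=> l hl; rewrite rowS //; have [//| ->] := bd l.+1.
have left k : (k <= n)%N -> entry h k 0 = k%:Z.
  move=> hk.
  rewrite (@arith_progression (fun i => entry h i 0) 1 n) ?h00 //; first lia.
  by move=> l hl; rewrite colS //; have [//| _ _ ->] := bd l.+1.
have bottom k : (k <= n)%N -> entry h n k = n%:Z - k%:Z.
  move=> hk; rewrite (@arith_progression (entry h n) (-1) n) ?left //; first lia.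
  by move=> l hl; rewrite rowS //; have [//| _ /negPf->] := bd l.+1.
have rightside k : (k <= n)%N -> entry h k n = n%:Z - k%:Z.
  move=> hk.
  rewrite (@arith_progression (fun i => entry h i n) (-1) n) ?top //; first lia.
  by move=> l hl; rewrite colS //; have [//| _ _ _ /negPf->] := bd l.+1.
apply/and3P; split.
- apply/forallP=> i; apply/forallP=> j.
  by rewrite colS ?ltn_ord //; [case: ifP | rewrite -ltnS].
- apply/forallP=> i; apply/forallP=> j.
  by rewrite rowS ?ltn_ord //; [case: ifP | rewrite -ltnS].
- apply/forallP=> i; have hi : (i <= n)%N by rewrite -ltnS.
  by rewrite left // top // bottom ?leq_subr // rightside ?leq_subr //; lia.
Qed.

(** The prescribed sides have constant steps: [1] on the left and top, [-1] on
    the right and bottom. *)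
Lemma height_open_boundary n (o : orientation n) (h : 'M[int]_n.+1) :
  has_differences o h -> is_height h -> open_boundary o.
Proof.
move=> [row col] /height_sides side; apply/open_boundaryP => k hk.
have [hk1 hk0] : (k <= n)%N /\ (k.-1 <= n)%N by lia.
have [e1 e2 e3 e4] := side k hk1; have [e1' e2' e3' e4'] := side _ hk0.
rewrite /up /right; split.
- by have := row 0%N k isT hk; rewrite e2 e2'; case: ifP => //; lia.
- by have := row n k (leqnn n) hk; rewrite e4 e4'; case: ifP => //; lia.
- by have := col k 0%N hk isT; rewrite e1 e1'; case: ifP => //; lia.
- by have := col k n hk (leqnn n); rewrite e3 e3'; case: ifP => //; lia.
Qed.

(** The ice rule is the closedness of the four steps around a vertex, and so
    holds for the differences of any matrix. *)
Lemma differences_state n (o : orientation n) (h : 'M[int]_n.+1) :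
  has_differences o h -> is_state o.
Proof.
move=> [row col]; apply/stateP => i j hi hj.
have [hi1 hi0] : (i <= n)%N /\ (i.-1 <= n)%N by lia.
have [hj1 hj0] : (j <= n)%N /\ (j.-1 <= n)%N by lia.
have := row i j hi1 hj; have := row i.-1 j hi0 hj.
have := col i j hi hj1; have := col i j.-1 hi hj0.
rewrite -/(up o i j) -/(up o i.-1 j) -/(right o i j) -/(right o i j.-1).
by case: (up o i j) (up o i.-1 j) (right o i j) (right o i j.-1)
  => [] [] [] [] /=; lia.
Qed.

(** The matrix obtained by walking down the leftmost column and then along
    row [i].  Horizontal differences are right by construction; the ice rule
    propagates the vertical ones from column [j] to column [j+1]. *)
Lemma integrate_state n (o : orientation n) :
  is_state o -> open_boundary o ->
  exists2 h : 'M[int]_n.+1, entry h 0 0 = 0 & has_differences o h.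
Proof.
move=> /stateP ice /open_boundaryP bd.
pose g i j : int := i%:Z + \sum_(k < j) (if up o i k.+1 then 1 else -1).
have g0 i : g i 0%N = i%:Z by rewrite /g big_ord0 addr0.
have gS i j : g i j.+1 = g i j + (if up o i j.+1 then 1 else -1).
  by rewrite /g big_ord_recr addrA.
pose h : 'M[int]_n.+1 := \matrix_(i, j) g i j.
have hE i j : (i <= n)%N -> (j <= n)%N -> entry h i j = g i j.
  by move=> hi hj; rewrite /entry mxE !inordK.
exists h; first by rewrite hE // g0.
split=> [i [//|j] hi hj|[//|i] j hi hj].
  by rewrite !hE //=; [rewrite gS addrC addKr | exact: ltnW].
rewrite !hE //=; last exact: ltnW.
rewrite -/(right o i.+1 j); elim: j hj => [|j IH] hj.
  by rewrite !g0; have [_ _ -> _] := bd i.+1 hi; lia.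
have := ice i.+1 j.+1 hi hj; have /= := IH (ltnW hj); rewrite !gS /=.
by case: (up o i.+1 j.+1) (up o i j.+1) (right o i.+1 j)
  (right o i.+1 j.+1) => [] [] [] []; lia.
Qed.

(** Since the steps of [h] are [1] or [-1], they are encoded by the bits
    telling which of them equal [1]. *)
Lemma height_differences n (h : 'M[int]_n.+1) :
  is_height h -> exists o : orientation n, has_differences o h.
Proof.
case/and3P=> /forallP vert /forallP horiz _.
have [o [hup hright]] := orientation_of_bits n
  (fun i j => entry h i j - entry h i j.-1 == 1)
  (fun i j => entry h i j - entry h i.-1 j == 1).
have unit (x : int) : `|x| = 1 -> x = if x == 1 then 1 else -1.
  by case: eqP; lia.
exists o; split=> [i [//|j] hi hj|[//|i] j hi hj].
  rewrite -/(up o i j.+1) hup //; apply: unit => /=.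
  have /forallP/(_ (Ordinal (hj : (j < n)%N)))/eqP :=
    horiz (Ordinal (hi : (i < n.+1)%N)).
  exact.
rewrite -/(right o i.+1 j) hright //; apply: unit => /=.
have /forallP/(_ (Ordinal (hj : (j < n.+1)%N)))/eqP :=
  vert (Ordinal (hi : (i < n)%N)).
exact.
Qed.

(** * The bijection *)

Theorem proposition3p1 (n : nat) (n_gt0 : (0 < n)%N) :
  exists f : SV n -> height_function n,
    (forall (phi : SV n) (h : height_function n),
       has_differences (val phi) (val h) <-> h = f phi)
    /\ bijective f.
Proof.
have corner (h : height_function n) : entry (val h) 0 0 = 0.
  by have [] := height_sides (valP h) (leq0n n).
have /fin_all_exists[f hf] : forall phi : SV n,
    exists h : height_function n, has_differences (val phi) (val h).
  move=> phi; have /andP[st bd] := valP phi.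
  have [h h00 hd] := integrate_state st bd.
  by exists (Sub h (differences_height hd h00 bd)).
have fE phi h : has_differences (val phi) (val h) <-> h = f phi.
  split=> [hd|-> //]; apply/val_inj/(differences_inj hd (hf phi)).
  by rewrite !corner.
exists f; split=> //.
have f_inj : injective f.
  move=> phi psi E; apply/val_inj.
  have [row col] := hf phi; have [row' col'] := hf psi; rewrite -E in row' col'.
  have bitE (b c : bool) :
      (if b then 1 else -1) = (if c then 1 else -1) :> int -> b = c.
    by case: b c => [] [].
  apply: orientation_bits_inj => i j hi hj; apply: bitE.
    by rewrite -[RHS]row' // -row.
  by rewrite -[RHS]col' // -col.
have f_surj (h : height_function n) : exists phi, f phi == h.
  have [o hd] := height_differences (valP h).
  have so : is_state o && open_boundary o.
    by rewrite (differences_state hd) (height_open_boundary hd (valP h)).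
  by exists (Sub o so); apply/eqP/esym/fE.
exists (fun h => xchoose (f_surj h)) => [phi|h].
  by apply/f_inj/eqP/(xchooseP (f_surj (f phi))).
exact/eqP/(xchooseP (f_surj h)).
Qed.
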